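(* For each pair (logic $\mathbf{X}$, calculus $\mathbf{G3X}$) in the correspondence listed in the context, and for all finite multisets of formulas $\Gamma,\Delta$: $\Gamma\Rightarrow\Delta$ is derivable in $\mathbf{G3X}$ if and only if $\mathbf{X}\vdash\bigwedge\Gamma\supset\bigvee\Delta$, where an empty conjunction is $\top$ and an empty disjunction is $\bot$.
   Context: Formulas are generated from countably many propositional variables $p_0,p_1,\dots$ and the $0$-ary constant $\bot$ by the binary connectives $\wedge,\vee,\supset$ and the unary operator $\Box$; $\neg A:=A\supset\bot$, $\top:=\bot\supset\bot$, $A\leftrightarrow B:=(A\supset B)\wedge(B\supset A)$, $\Diamond A:=\neg\Box\neg A$. Axiomatic systems: $\mathbf{L}$ has as axioms all instances (in this language) of propositional tautologies and modus ponens as rule; $\mathbf{E}$ is $\mathbf{L}$ plus the rule $RE$: from $A\leftrightarrow B$ infer $\Box A\leftrightarrow\Box B$. Axiom schemes: $M$: $\Box(A\wedge B)\supset(\Box A\wedge\Box B)$; $C$: $(\Box A\wedge\Box B)\supset\Box(A\wedge B)$; $N$: $\Box\top$; $D^\bot$: $\neg\Box\bot$; $D^\Diamond$: $\Box A\supset\Diamond A$. Logics and corresponding calculi: $\mathbf{E}$ ($\mathbf{G3E}$); $\mathbf{E}\oplus N$ ($\mathbf{G3EN}$); $\mathbf{E}\oplus M$ ($\mathbf{G3M}$); $\mathbf{E}\oplus M\oplus N$ ($\mathbf{G3MN}$); $\mathbf{E}\oplus C$ ($\mathbf{G3C}$); $\mathbf{E}\oplus C\oplus N$ ($\mathbf{G3CN}$);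 $\mathbf{E}\oplus M\oplus C$ ($\mathbf{G3R}$); $\mathbf{E}\oplus M\oplus C\oplus N$ ($\mathbf{G3K}$); and, for $\mathbf{Y}$ one of these modal logics with calculus $\mathbf{G3Y}$: $\mathbf{Y}\oplus D^\bot$ corresponds to $\mathbf{G3YD^\bot}$, $\mathbf{Y}\oplus D^\Diamond$ to $\mathbf{G3YD^\Diamond}$, and $\mathbf{Y}\oplus D^\bot\oplus D^\Diamond$ to $\mathbf{G3YD}$, for those deontic calculi listed below. Sequents $\Gamma\Rightarrow\Delta$ have $\Gamma,\Delta$ finite, possibly empty multisets; $\Box\Pi=\Box A_1,\dots,\Box A_m$ for $\Pi=A_1,\dots,A_m$. $\mathbf{G3cp}$: initial sequents $p,\Gamma\Rightarrow\Delta,p$ ($p$ a propositional variable), zero-premiss rule $L\bot$ with conclusion $\bot,\Gamma\Rightarrow\Delta$, and rules (premisses / conclusion): $L\wedge$: $A,B,\Gamma\Rightarrow\Delta$ / $A\wedge B,\Gamma\Rightarrow\Delta$; $R\wedge$: $\Gamma\Rightarrow\Delta,A$ and $\Gamma\Rightarrow\Delta,B$ / $\Gamma\Rightarrow\Delta,A\wedge B$; $L\vee$: $A,\Gamma\Rightarrow\Delta$ and $B,\Gamma\Rightarrow\Delta$ / $A\vee B,\Gamma\Rightarrow\Delta$; $R\vee$: $\Gamma\Rightarrow\Delta,A,B$ / $\Gamma\Rightarrow\Delta,A\vee B$; $L\supset$: $\Gamma\Rightarrow\Delta,A$ and $B,\Gamma\Rightarrow\Delta$ / $A\supset B,\Gamma\Rightarrow\Delta$;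 $R\supset$: $A,\Gamma\Rightarrow\Delta,B$ / $\Gamma\Rightarrow\Delta,A\supset B$. Modal and deontic rules ($\Gamma,\Delta$ arbitrary): $LR$-$E$: $A\Rightarrow B$ and $B\Rightarrow A$ / $\Box A,\Gamma\Rightarrow\Delta,\Box B$; $LR$-$M$: $A\Rightarrow B$ / $\Box A,\Gamma\Rightarrow\Delta,\Box B$; $LR$-$R$: $A,\Pi\Rightarrow B$ / $\Box A,\Box\Pi,\Gamma\Rightarrow\Delta,\Box B$; $LR$-$C$ ($n\ge1$): $A_1,\dots,A_n\Rightarrow B$ and $B\Rightarrow A_1$, …, $B\Rightarrow A_n$ / $\Box A_1,\dots,\Box A_n,\Gamma\Rightarrow\Delta,\Box B$; $LR$-$K$: $\Pi\Rightarrow B$ / $\Box\Pi,\Gamma\Rightarrow\Delta,\Box B$; $R$-$N$: $\Rightarrow B$ / $\Gamma\Rightarrow\Delta,\Box B$; $L$-$D^\bot$: $A\Rightarrow$ / $\Box A,\Gamma\Rightarrow\Delta$; $L$-$D^{\Diamond_E}$ ($|\Pi|\le2$): $\Pi\Rightarrow$ and $\Rightarrow\Pi$ / $\Box\Pi,\Gamma\Rightarrow\Delta$; $L$-$D^{\Diamond_M}$ ($|\Pi|\le2$): $\Pi\Rightarrow$ / $\Box\Pi,\Gamma\Rightarrow\Delta$; $L$-$D^{\Diamond_C}$: $\Pi,\Sigma\Rightarrow$ and $\Rightarrow A,B$ for every $A\in\Pi$, $B\in\Sigma$ / $\Box\Pi,\Box\Sigma,\Gamma\Rightarrow\Delta$;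 $L$-$D^*$: $\Pi\Rightarrow$ / $\Box\Pi,\Gamma\Rightarrow\Delta$. Calculi ($\mathbf{G3cp}$ plus): $\mathbf{G3E}$: $LR$-$E$; $\mathbf{G3EN}$: $LR$-$E$, $R$-$N$; $\mathbf{G3M}$: $LR$-$M$; $\mathbf{G3MN}$: $LR$-$M$, $R$-$N$; $\mathbf{G3C}$: $LR$-$C$; $\mathbf{G3CN}$: $LR$-$C$, $R$-$N$; $\mathbf{G3R}$: $LR$-$R$; $\mathbf{G3K}$: $LR$-$K$; $\mathbf{G3ED^\bot}$ / $\mathbf{G3END^\bot}$: rules of $\mathbf{G3E}$ / $\mathbf{G3EN}$ plus $L$-$D^\bot$; $\mathbf{G3ED^\Diamond}$: $\mathbf{G3E}$ plus $L$-$D^{\Diamond_E}$; $\mathbf{G3ED}$ / $\mathbf{G3END}$: $\mathbf{G3E}$ / $\mathbf{G3EN}$ plus $L$-$D^\bot$ and $L$-$D^{\Diamond_E}$; $\mathbf{G3MD^\bot}$ / $\mathbf{G3MND^\bot}$: $\mathbf{G3M}$ / $\mathbf{G3MN}$ plus $L$-$D^\bot$; $\mathbf{G3MD}$ / $\mathbf{G3MND}$: $\mathbf{G3M}$ / $\mathbf{G3MN}$ plus $L$-$D^{\Diamond_M}$; $\mathbf{G3CD^\Diamond}$: $\mathbf{G3C}$ plus $L$-$D^{\Diamond_C}$; $\mathbf{G3CD}$, $\mathbf{G3CND}$, $\mathbf{G3RD}$, $\mathbf{G3KD}$: $\mathbf{G3C}$, $\mathbf{G3CN}$, $\mathbf{G3R}$,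 $\mathbf{G3K}$ respectively plus $L$-$D^*$. A derivation is a finite upward-growing tree of sequents whose leaves are initial sequents or conclusions of $L\bot$ and each other node is the conclusion of a rule instance whose premisses are its children.
   Formalization: In rule L-D^{◇_C} the multisets Π and Σ are required to be nonempty; with Σ empty the displayed rule would derive □⊥ ⇒ in G3CD^◇, although E⊕C⊕D^◇ does not prove ¬□⊥. *)

(* Defs.v *)
From HB Require Import structures.
From mathcomp Require Import all_boot.
From mathcomp Require Import finmap multiset.

Set Implicit Arguments.
Unset Strict Implicit.
Unset Printing Implicit Defensive.

Open Scope mset_scope.

Inductive formula : Type :=
| Var of nat
| Bot
| And of formula & formula
| Or of formula & formula
| Imp of formula & formula
| Box of formula.

Definition Neg A := Imp A Bot.
Definition Top := Imp Bot Bot.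
Definition Iff A B := And (Imp A B) (Imp B A).
Definition Dia A := Neg (Box (Neg A)).

(* {mset formula} requires a choiceType on formula. *)
Fixpoint tree_of_formula (A : formula) : GenTree.tree nat :=
  match A with
  | Var n => GenTree.Leaf n
  | Bot => GenTree.Node 0 [::]
  | And B C => GenTree.Node 1 [:: tree_of_formula B; tree_of_formula C]
  | Or B C => GenTree.Node 2 [:: tree_of_formula B; tree_of_formula C]
  | Imp B C => GenTree.Node 3 [:: tree_of_formula B; tree_of_formula C]
  | Box B => GenTree.Node 4 [:: tree_of_formula B]
  end.

Fixpoint formula_of_tree (t : GenTree.tree nat) : formula :=
  match t with
  | GenTree.Leaf n => Var n
  | GenTree.Node 1 [:: u; v] => And (formula_of_tree u) (formula_of_tree v)
  | GenTree.Node 2 [:: u; v] => Or (formula_of_tree u) (formula_of_tree v)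
  | GenTree.Node 3 [:: u; v] => Imp (formula_of_tree u) (formula_of_tree v)
  | GenTree.Node 4 [:: u] => Box (formula_of_tree u)
  | _ => Bot
  end.

Lemma tree_of_formulaK : cancel tree_of_formula formula_of_tree.
Proof. by elim=> //= [A -> B ->|A -> B ->|A -> B ->|A ->]. Qed.

HB.instance Definition _ := Countable.copy formula (can_type tree_of_formulaK).

Inductive pform : Type :=
| PVar of nat
| PBot
| PAnd of pform & pform
| POr of pform & pform
| PImp of pform & pform.

Fixpoint peval (v : nat -> bool) (P : pform) : bool :=
  match P with
  | PVar n => v n
  | PBot => false
  | PAnd Q R => peval v Q && peval v R
  | POr Q R => peval v Q || peval v R
  | PImp Q R => peval v Q ==> peval v R
  end.

Fixpoint psubst (s : nat -> formula) (P : pform) : formula :=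
  match P with
  | PVar n => s n
  | PBot => Bot
  | PAnd Q R => And (psubst s Q) (psubst s R)
  | POr Q R => Or (psubst s Q) (psubst s R)
  | PImp Q R => Imp (psubst s Q) (psubst s R)
  end.

Definition tautology (P : pform) : Prop := forall v, peval v P.

Definition taut_instance (A : formula) : Prop :=
  exists (P : pform) (s : nat -> formula), tautology P /\ A = psubst s P.

Variant scheme := AxM | AxC | AxN | AxDbot | AxDdia.

Definition scheme_comparable : comparable scheme.
Proof. by move=> x y; rewrite /decidable; decide equality. Defined.
HB.instance Definition _ := hasDecEq.Build scheme (compareP scheme_comparable).

(* Theoremhood in the system E extended with the axiom schemes listed in S. *)
Inductive provable (S : seq scheme) : formula -> Prop :=
| P_taut A : taut_instance A -> provable S A
| P_MP A B : provable S (Imp A B) -> provable S A -> provable S B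
| P_RE A B : provable S (Iff A B) -> provable S (Iff (Box A) (Box B))
| P_M A B : AxM \in S ->
    provable S (Imp (Box (And A B)) (And (Box A) (Box B)))
| P_C A B : AxC \in S ->
    provable S (Imp (And (Box A) (Box B)) (Box (And A B)))
| P_N : AxN \in S -> provable S (Box Top)
| P_Dbot : AxDbot \in S -> provable S (Neg (Box Bot))
| P_Ddia A : AxDdia \in S -> provable S (Imp (Box A) (Dia A)).

Variant rule :=
| LR_E | LR_M | LR_R | LR_C | LR_K | R_N
| L_Dbot | L_DdiaE | L_DdiaM | L_DdiaC | L_Dstar.

Definition rule_comparable : comparable rule.
Proof. by move=> x y; rewrite /decidable; decide equality. Defined.
HB.instance Definition _ := hasDecEq.Build rule (compareP rule_comparable).

Definition boxes (Pi : {mset formula}) : {mset formula} :=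
  seq_mset [seq Box A | A <- Pi].

(* derivable Rs Gamma Delta: the sequent Gamma => Delta is derivable in G3cp
   extended with the modal and deontic rules listed in Rs. *)
Inductive derivable (Rs : seq rule) : {mset formula} -> {mset formula} -> Prop :=
| D_init n G D :
    derivable Rs (Var n +` G) (Var n +` D)
| D_Lbot G D :
    derivable Rs (Bot +` G) D
| D_Land A B G D :
    derivable Rs (A +` (B +` G)) D ->
    derivable Rs (And A B +` G) D
| D_Rand A B G D :
    derivable Rs G (A +` D) -> derivable Rs G (B +` D) ->
    derivable Rs G (And A B +` D)
| D_Lor A B G D :
    derivable Rs (A +` G) D -> derivable Rs (B +` G) D ->
    derivable Rs (Or A B +` G) D
| D_Ror A B G D :
    derivable Rs G (A +` (B +` D)) ->
    derivable Rs G (Or A B +` D)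
| D_Limp A B G D :
    derivable Rs G (A +` D) -> derivable Rs (B +` G) D ->
    derivable Rs (Imp A B +` G) D
| D_Rimp A B G D :
    derivable Rs (A +` G) (B +` D) ->
    derivable Rs G (Imp A B +` D)
| D_LR_E A B G D : LR_E \in Rs ->
    derivable Rs [mset A] [mset B] -> derivable Rs [mset B] [mset A] ->
    derivable Rs (Box A +` G) (Box B +` D)
| D_LR_M A B G D : LR_M \in Rs ->
    derivable Rs [mset A] [mset B] ->
    derivable Rs (Box A +` G) (Box B +` D)
| D_LR_R A (Pi : {mset formula}) B G D : LR_R \in Rs ->
    derivable Rs (A +` Pi) [mset B] ->
    derivable Rs (Box A +` (boxes Pi `+` G)) (Box B +` D)
| D_LR_C (Pi : {mset formula}) B G D : LR_C \in Rs ->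
    Pi != mset0 ->
    derivable Rs Pi [mset B] ->
    (forall A, A \in Pi -> derivable Rs [mset B] [mset A]) ->
    derivable Rs (boxes Pi `+` G) (Box B +` D)
| D_LR_K (Pi : {mset formula}) B G D : LR_K \in Rs ->
    derivable Rs Pi [mset B] ->
    derivable Rs (boxes Pi `+` G) (Box B +` D)
| D_R_N B G D : R_N \in Rs ->
    derivable Rs mset0 [mset B] ->
    derivable Rs G (Box B +` D)
| D_L_Dbot A G D : L_Dbot \in Rs ->
    derivable Rs [mset A] mset0 ->
    derivable Rs (Box A +` G) D
| D_L_DdiaE (Pi : {mset formula}) G D : L_DdiaE \in Rs ->
    size Pi <= 2 ->
    derivable Rs Pi mset0 -> derivable Rs mset0 Pi ->
    derivable Rs (boxes Pi `+` G) D
| D_L_DdiaM (Pi : {mset formula}) G D : L_DdiaM \in Rs ->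
    size Pi <= 2 ->
    derivable Rs Pi mset0 ->
    derivable Rs (boxes Pi `+` G) D
(* Pi and Sigma must be nonempty: with Sigma empty the second family of
   premisses is vacuous, and Bot => would yield Box Bot =>, although
   Neg (Box Bot) is not a theorem of E + C + Ddia. *)
| D_L_DdiaC (Pi Sigma : {mset formula}) G D : L_DdiaC \in Rs ->
    Pi != mset0 -> Sigma != mset0 ->
    derivable Rs (Pi `+` Sigma) mset0 ->
    (forall A B, A \in Pi -> B \in Sigma -> derivable Rs mset0 [mset A; B]) ->
    derivable Rs (boxes Pi `+` (boxes Sigma `+` G)) D
| D_L_Dstar (Pi : {mset formula}) G D : L_Dstar \in Rs ->
    derivable Rs Pi mset0 ->
    derivable Rs (boxes Pi `+` G) D.

Variant logic :=
| LE | LEN | LM | LMN | LC | LCN | LR | LK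
| LEDbot | LENDbot | LEDdia | LED | LEND
| LMDbot | LMNDbot | LMD | LMND
| LCDdia | LCD | LCND | LRD | LKD.

Definition axioms (X : logic) : seq scheme :=
  match X with
  | LE => [::]
  | LEN => [:: AxN]
  | LM => [:: AxM]
  | LMN => [:: AxM; AxN]
  | LC => [:: AxC]
  | LCN => [:: AxC; AxN]
  | LR => [:: AxM; AxC]
  | LK => [:: AxM; AxC; AxN]
  | LEDbot => [:: AxDbot]
  | LENDbot => [:: AxN; AxDbot]
  | LEDdia => [:: AxDdia]
  | LED => [:: AxDbot; AxDdia]
  | LEND => [:: AxN; AxDbot; AxDdia]
  | LMDbot => [:: AxM; AxDbot]
  | LMNDbot => [:: AxM; AxN; AxDbot]
  | LMD => [:: AxM; AxDbot; AxDdia]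
  | LMND => [:: AxM; AxN; AxDbot; AxDdia]
  | LCDdia => [:: AxC; AxDdia]
  | LCD => [:: AxC; AxDbot; AxDdia]
  | LCND => [:: AxC; AxN; AxDbot; AxDdia]
  | LRD => [:: AxM; AxC; AxDbot; AxDdia]
  | LKD => [:: AxM; AxC; AxN; AxDbot; AxDdia]
  end.

Definition rules (X : logic) : seq rule :=
  match X with
  | LE => [:: LR_E]
  | LEN => [:: LR_E; R_N]
  | LM => [:: LR_M]
  | LMN => [:: LR_M; R_N]
  | LC => [:: LR_C]
  | LCN => [:: LR_C; R_N]
  | LR => [:: LR_R]
  | LK => [:: LR_K]
  | LEDbot => [:: LR_E; L_Dbot]
  | LENDbot => [:: LR_E; R_N; L_Dbot]
  | LEDdia => [:: LR_E; L_DdiaE]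
  | LED => [:: LR_E; L_Dbot; L_DdiaE]
  | LEND => [:: LR_E; R_N; L_Dbot; L_DdiaE]
  | LMDbot => [:: LR_M; L_Dbot]
  | LMNDbot => [:: LR_M; R_N; L_Dbot]
  | LMD => [:: LR_M; L_DdiaM]
  | LMND => [:: LR_M; R_N; L_DdiaM]
  | LCDdia => [:: LR_C; L_DdiaC]
  | LCD => [:: LR_C; L_Dstar]
  | LCND => [:: LR_C; R_N; L_Dstar]
  | LRD => [:: LR_R; L_Dstar]
  | LKD => [:: LR_K; L_Dstar]
  end.

(* Right-nested, and A itself (not And A Top) on a singleton. *)
Fixpoint conj_seq (s : seq formula) : formula :=
  match s with
  | [::] => Top
  | [:: A] => A
  | A :: s' => And A (conj_seq s')
  end.

Fixpoint disj_seq (s : seq formula) : formula :=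
  match s with
  | [::] => Bot
  | [:: A] => A
  | A :: s' => Or A (disj_seq s')
  end.

(* Conjunction and disjunction of a multiset, along its enumeration. *)
Definition bigconj (G : {mset formula}) : formula := conj_seq (enum_mset G).
Definition bigdisj (D : {mset formula}) : formula := disj_seq (enum_mset D).

(* Main.v *)
Require Import Defs.
From mathcomp Require Import all_boot finmap multiset.
From mathcomp Require Import zify boolp.

(** Soundness is by induction on derivations.  Completeness is semantic and needs
    neither cut nor contraction.  Decomposing an underivable sequent root-first
    yields a saturated sequent; all saturated sequents are the worlds of one
    neighbourhood model, in which formulas on the left are true and formulas on
    the right are false.  When the boxed formulas [Box A], [A] in [s], stand on
    the left of [w], every set of worlds between "all of [s] on the left" and
    "none of [s] on the right" is a neighbourhood of [w].  The modal and deontic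
    rules are then exactly what is needed for the truth lemma and for the validity
    of the axioms, because a sequent without a saturated extension is derivable. *)

Set Implicit Arguments.
Unset Strict Implicit.
Unset Printing Implicit Defensive.

Local Open Scope mset_scope.

(** * Boolean predicates over multisets *)

Lemma all_msetD (p : pred formula) (A B : {mset formula}) :
  all p (A `+` B) = all p A && all p B.
Proof.
apply/allP/andP => [pAB|[/allP pA /allP pB] C].
  by split; apply/allP => C CA; apply: pAB; rewrite in_msetD CA ?orbT.
by rewrite in_msetD => /orP[/pA|/pB].
Qed.

Lemma has_msetD (p : pred formula) (A B : {mset formula}) :
  has p (A `+` B) = has p A || has p B.
Proof.
by apply: negb_inj; rewrite negb_or -!all_predC all_msetD.
Qed.

Lemma enum_mset_eq0 (A : {mset formula}) :
  (enum_mset A == [::]) = (A == mset0).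
Proof.
apply/eqP/eqP => [A0|->]; last exact: enum_mset0.
by rewrite -[A]seq_mset_id A0; apply/msetP => B; rewrite mset_seqE mset0E.
Qed.

Lemma all_mset1 (p : pred formula) A : all p [mset A] = p A.
Proof. by rewrite enum_msetn /= andbT. Qed.

Lemma has_mset1 (p : pred formula) A : has p [mset A] = p A.
Proof. by rewrite enum_msetn /= orbF. Qed.

Lemma all_boxes (p : pred formula) Pi :
  all p (boxes Pi) = all (fun A => p (Box A)) Pi.
Proof. by rewrite /boxes (perm_all _ (perm_eq_seq_mset _)) all_map. Qed.

(** * Propositional reasoning in the axiomatic systems *)

Fixpoint feval (v : pred formula) (A : formula) : bool :=
  match A with
  | Var _ | Box _ => v A
  | Bot => false
  | And B C => feval v B && feval v C
  | Or B C => feval v B || feval v C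
  | Imp B C => feval v B ==> feval v C
  end.

(* The coding is a parameter because simplification would unfold [pickle]. *)
Fixpoint pform_of (code : formula -> nat) (A : formula) : pform :=
  match A with
  | Var _ | Box _ => PVar (code A)
  | Bot => PBot
  | And B C => PAnd (pform_of code B) (pform_of code C)
  | Or B C => POr (pform_of code B) (pform_of code C)
  | Imp B C => PImp (pform_of code B) (pform_of code C)
  end.

Lemma psubst_pform_of code s A :
  cancel code s -> psubst s (pform_of code A) = A.
Proof. by move=> sK; elim: A => //= [B -> C ->|B -> C ->|B -> C ->]. Qed.

Lemma peval_pform_of code v A :
  peval v (pform_of code A) = feval (v \o code) A.
Proof. by elim: A => //= [B -> C ->|B -> C ->|B -> C ->]. Qed.

(** Variables and boxed formulas are the atoms: coding them as propositional variables and decoding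
    by substitution exhibits [A] as an instance of a tautology. *)
Lemma provable_valid S A : (forall v, feval v A) -> provable S A.
Proof.
move=> valA; apply: P_taut.
exists (pform_of choice.pickle A), (odflt Bot \o choice.unpickle).
split=> [v|]; first by rewrite peval_pform_of.
by rewrite psubst_pform_of // => B; rewrite [LHS]/comp choice.pickleK.
Qed.

(** Each premiss is discharged by modus ponens from a curried tautology, so every propositional step
    below becomes a Boolean check. *)
Lemma provable_conseq S (s : seq formula) B :
  (forall A, A \in s -> provable S A) ->
  (forall v, all (feval v) s -> feval v B) -> provable S B.
Proof.
elim: s B => [|A s IHs] B prs sB; first by apply: provable_valid => v; apply: sB.
apply: (@P_MP _ A); last by apply: prs; rewrite mem_head.
apply: IHs => [C Cs|v vs /=]; first by apply: prs; rewrite inE Cs orbT.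
by apply/implyP => vA; apply: sB; rewrite /= vA.
Qed.

Lemma provable_conseq1 S A B : provable S A ->
  (forall v, feval v A -> feval v B) -> provable S B.
Proof.
move=> prA AB; apply: (@provable_conseq S [:: A]) => [C|v /= /andP[/AB]//].
by rewrite inE => /eqP->.
Qed.

Lemma provable_conseq2 S A1 A2 B : provable S A1 -> provable S A2 ->
  (forall v, feval v A1 -> feval v A2 -> feval v B) -> provable S B.
Proof.
move=> prA1 prA2 AB; apply: (@provable_conseq S [:: A1; A2]) => [C|v /=].
  by rewrite !inE => /orP[]/eqP->.
by rewrite andbT => /andP[] /AB; apply.
Qed.

Lemma feval_conj v s : feval v (conj_seq s) = all (feval v) s.
Proof. by elim: s => //= A [|B s] /=; rewrite ?andbT // => ->. Qed.

Lemma feval_disj v s : feval v (disj_seq s) = has (feval v) s.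
Proof. by elim: s => //= A [|B s] /=; rewrite ?orbF // => ->. Qed.

Definition seq_formula (G D : {mset formula}) : formula :=
  Imp (bigconj G) (bigdisj D).

Lemma feval_seq v G D :
  feval v (seq_formula G D) = (all (feval v) G ==> has (feval v) D).
Proof. by rewrite /= feval_conj feval_disj. Qed.

Lemma bigconj1 A : bigconj [mset A] = A.
Proof. by rewrite /bigconj enum_msetn. Qed.

Lemma bigdisj1 A : bigdisj [mset A] = A.
Proof. by rewrite /bigdisj enum_msetn. Qed.

Lemma bigdisj0 : bigdisj mset0 = Bot.
Proof. by rewrite /bigdisj enum_mset0. Qed.

Lemma bigconj0 : bigconj mset0 = Top.
Proof. by rewrite /bigconj enum_mset0. Qed.

(** * Soundness of the sequent calculi *)

Lemma provable_box_iff S A B : provable S (Imp A B) -> provable S (Imp B A) ->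
  provable S (Imp (Box A) (Box B)).
Proof.
move=> AB BA; have : provable S (Iff (Box A) (Box B)).
  by apply: P_RE; apply: provable_conseq2 AB BA _ => v /= -> ->.
by move=> /provable_conseq1; apply=> v /= /andP[].
Qed.

(** If [A] implies [B], then [A] is equivalent to [And A B]; RE followed by M gives the claim. *)
Lemma provable_box_mono S A B : AxM \in S -> provable S (Imp A B) ->
  provable S (Imp (Box A) (Box B)).
Proof.
move=> SM AB; have box_and : provable S (Imp (Box A) (Box (And A B))).
  apply: provable_box_iff; last by apply: provable_valid => v /=; case: (feval v A); case: (feval v B).
  by apply: provable_conseq1 AB _ => v /=; case: (feval v A) => //= ->.
apply: provable_conseq2 box_and (P_M A B SM) _ => v /=.
by case: (v (Box A)); case: (v (Box (And A B))) => //= _ /andP[].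
Qed.

Lemma provable_box_conj S (s : seq formula) : AxC \in S ->
  s != [::] \/ AxN \in S ->
  provable S (Imp (conj_seq [seq Box A | A <- s]) (Box (conj_seq s))).
Proof.
move=> SC; case: s => [[//|SN]|A s _].
  by apply: provable_conseq1 (P_N SN) _ => v /= ->.
elim: s A => [|B s IHs] A; first by apply: provable_valid => v /=; case: v.
apply: provable_conseq2 (IHs B) (P_C A (conj_seq (B :: s)) SC) _ => v.
rewrite [feval v _]/= -/(conj_seq (B :: s)) => IH1 IH2; move: IH1 IH2 => /=.
by case: (v (Box A)) => //= /implyP IH1 /implyP IH2; apply/implyP=> /IH1/IH2.
Qed.

(** Common core of [LR_R], [LR_C] and [LR_K]: C (or N, for empty [Pi]) merges the boxes into one box
    of the conjunction, from which M, or RE with the converse premisses, leads to [Box B]. *)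
Lemma provable_box_sequent S (Pi : {mset formula}) B :
  AxC \in S -> (Pi != mset0) || (AxN \in S) ->
  provable S (seq_formula Pi [mset B]) ->
  AxM \in S \/
    (forall A, A \in Pi -> provable S (seq_formula [mset B] [mset A])) ->
  provable S (Imp (conj_seq [seq Box A | A <- Pi]) (Box B)).
Proof.
move=> SC Pi0; rewrite /seq_formula bigdisj1 => PiB BPi.
have Pi0' : enum_mset Pi != [::] \/ AxN \in S.
  case/orP: Pi0 => [Pi0|]; last by right.
  by left; rewrite enum_mset_eq0.
suff conjB : provable S (Imp (Box (bigconj Pi)) (Box B)).
  apply: provable_conseq2 (provable_box_conj SC Pi0') conjB _ => v /=.
  by case: feval => //= ->.
case: BPi => [SM|BPi]; first exact: provable_box_mono.
apply: provable_box_iff => //.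
apply: (@provable_conseq _ [seq Imp B A | A <- Pi]) => [C /mapP[A APi ->]|v].
  by have := BPi A APi; rewrite /seq_formula bigconj1 bigdisj1.
rewrite /= feval_conj => /allP vBPi; apply/implyP => vB; apply/allP => A APi.
by have /= := vBPi _ (map_f (Imp B) APi); rewrite vB.
Qed.

Definition rule_axioms (r : rule) : seq scheme :=
  match r with
  | LR_E => [::]
  | LR_M => [:: AxM]
  | LR_R => [:: AxM; AxC]
  | LR_C => [:: AxC]
  | LR_K => [:: AxM; AxC; AxN]
  | R_N => [:: AxN]
  | L_Dbot => [:: AxDbot]
  | L_DdiaE => [:: AxDdia]
  | L_DdiaM => [:: AxM; AxDbot; AxDdia]
  | L_DdiaC => [:: AxC; AxDdia]
  | L_Dstar => [:: AxC; AxDbot]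
  end.

Lemma rules_axioms X r : r \in rules X -> {subset rule_axioms r <= axioms X}.
Proof. by move=> rX a; move: rX; case: X; case: r => //; case: a. Qed.

(** A refutable conjunction is equivalent to [Bot], so RE turns its box into [Box Bot]. For empty
    [Pi] the premiss is already contradictory. *)
Lemma provable_dstar S (Pi : {mset formula}) : AxC \in S -> AxDbot \in S ->
  provable S (seq_formula Pi mset0) ->
  provable S (seq_formula (boxes Pi) mset0).
Proof.
move=> SC SDbot; case: (eqVneq Pi mset0) => [->|Pi0] PiF.
  apply: provable_conseq1 PiF _ => v; rewrite !feval_seq all_boxes.
  by rewrite enum_mset0.
have conj_box : enum_mset Pi != [::] \/ AxN \in S.
  by left; rewrite enum_mset_eq0.
have conj_bot : provable S (Imp (Box (bigconj Pi)) (Box Bot)).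
  apply: provable_box_iff; last exact: provable_valid.
  by rewrite -bigdisj0.
apply: (@provable_conseq _ [:: Neg (Box Bot); Imp (Box (bigconj Pi)) (Box Bot);
   Imp (conj_seq [seq Box A | A <- Pi]) (Box (bigconj Pi))]) => [C|v].
  rewrite !inE => /or3P[]/eqP-> //; first exact: P_Dbot.
  exact: provable_box_conj.
rewrite feval_seq all_boxes enum_mset0 /= feval_conj all_map /=.
by case: (v (Box Bot)); case: (v (Box (bigconj Pi))); rewrite ?andbF ?andbT.
Qed.

(** [Box A] yields [Box (Neg B)], which the scheme for [B] forbids beside [Box B]. *)
Lemma provable_ddia S A B : AxDdia \in S -> provable S (Imp A (Neg B)) ->
  AxM \in S \/ provable S (Imp (Neg B) A) ->
  provable S (Neg (And (Box A) (Box B))).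
Proof.
move=> SD AB BA.
have boxAB : provable S (Imp (Box A) (Box (Neg B))).
  by case: BA => [SM|BA]; [apply: provable_box_mono|apply: provable_box_iff].
apply: provable_conseq2 boxAB (P_Ddia B SD) _ => v /=.
by case: (v (Box A)); case: (v (Box B)); case: (v (Box (Neg B))).
Qed.

Theorem soundness X G D :
  derivable (rules X) G D -> provable (axioms X) (seq_formula G D).
Proof.
have RA r a : r \in rules X -> a \in rule_axioms r -> a \in axioms X.
  by move=> /rules_axioms; apply.
(* These equations reduce each propositional rule to a finite Boolean case analysis. *)
have fevalE := (feval_seq, all_msetD, has_msetD, all_mset1, has_mset1,
  all_boxes, @enum_mset0 formula).
elim=> {G D}.
- move=> n G D; apply: provable_valid => v; rewrite !fevalE /=.
  by case: (v (Var n)); rewrite ?implybT.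
- by move=> G D; apply: provable_valid => v; rewrite !fevalE.
- move=> A B G D _ /provable_conseq1; apply=> v; rewrite !fevalE /=.
  by rewrite andbA.
- move=> A B G D _ IH1 _ IH2; apply: provable_conseq2 IH1 IH2 _ => v.
  by rewrite !fevalE /=; case: (feval v A); case: (feval v B); case: all; case: has.
- move=> A B G D _ IH1 _ IH2; apply: provable_conseq2 IH1 IH2 _ => v.
  by rewrite !fevalE /=; case: (feval v A); case: (feval v B); case: all; case: has.
- move=> A B G D _ /provable_conseq1; apply=> v; rewrite !fevalE /=.
  by rewrite orbA.
- move=> A B G D _ IH1 _ IH2; apply: provable_conseq2 IH1 IH2 _ => v.
  by rewrite !fevalE /=; case: (feval v A); case: (feval v B); case: all; case: has.
- move=> A B G D _ /provable_conseq1; apply=> v; rewrite !fevalE /=.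
  by case: (feval v A); case: (feval v B); case: all; case: has.
- move=> A B G D _ _ IH1 _ IH2.
  rewrite /seq_formula !bigconj1 !bigdisj1 in IH1 IH2.
  apply: provable_conseq1 (provable_box_iff IH1 IH2) _ => v.
  by rewrite !fevalE /=; case: (v (Box A)); case: (v (Box B)); rewrite ?implybT.
- move=> A B G D /RA SM _ IH; rewrite /seq_formula bigconj1 bigdisj1 in IH.
  apply: provable_conseq1 (provable_box_mono (SM AxM _) IH) _ => // v.
  by rewrite !fevalE /=; case: (v (Box A)); case: (v (Box B)); rewrite ?implybT.
- move=> A Pi B G D /RA SR _ IH.
  have nz : (A +` Pi != mset0) || (AxN \in axioms X).
    by rewrite (contraTneq _ (mset1D1 A Pi)) // => ->; rewrite in_mset0.
  have /provable_conseq1 :=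
    provable_box_sequent (SR AxC isT) nz IH (or_introl (SR AxM isT)).
  apply=> v; rewrite !fevalE /= feval_conj all_map all_msetD all_mset1 /=.
  by case: (v (Box B)); rewrite ?implybT // andbA implybF => /negbTE->.
- move=> Pi B G D /RA SR Pi0 _ IH1 _ IH2.
  have nz : (Pi != mset0) || (AxN \in axioms X) by rewrite Pi0.
  have /provable_conseq1 :=
    provable_box_sequent (SR AxC isT) nz IH1 (or_intror IH2).
  apply=> v; rewrite !fevalE /= feval_conj all_map /=.
  by case: (v (Box B)); rewrite ?implybT // implybF => /negbTE->.
- move=> Pi B G D /RA SR _ IH.
  have nz : (Pi != mset0) || (AxN \in axioms X) by rewrite SR ?orbT.
  have /provable_conseq1 :=
    provable_box_sequent (SR AxC isT) nz IH (or_introl (SR AxM isT)).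
  apply=> v; rewrite !fevalE /= feval_conj all_map /=.
  by case: (v (Box B)); rewrite ?implybT // implybF => /negbTE->.
- move=> B G D /RA SN _; rewrite /seq_formula bigconj0 bigdisj1 => IH.
  have TB : provable (axioms X) (Imp (Box Top) (Box B)).
    by apply: provable_box_iff => //; apply: provable_valid => v /=; rewrite implybT.
  apply: provable_conseq2 TB (P_N (SN AxN isT)) _ => v.
  by rewrite !fevalE /= => /implyP H /H ->; rewrite implybT.
- move=> A G D /RA SD _; rewrite /seq_formula bigconj1 bigdisj0 => IH.
  have AB : provable (axioms X) (Imp (Box A) (Box Bot)).
    by apply: provable_box_iff => //; apply: provable_valid.
  apply: provable_conseq2 AB (P_Dbot (SD AxDbot isT)) _ => v.
  by rewrite !fevalE /=; case: (v (Box A)); case: (v (Box Bot)).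
- move=> Pi G D /RA SD sz2 _ IH1 _ IH2; move: sz2 IH1 IH2.
  rewrite /seq_formula bigconj0 bigdisj0 /bigconj /bigdisj.
  (* With no formula or one, the premisses contradict each other; with two, they make [A] equivalent
     to [Neg B]. *)
  case E: (enum_mset Pi) => [|A [|B []]] // _ IH1 IH2.
  + by apply: provable_conseq1 IH1 _ => v.
  + by apply: provable_conseq2 IH1 IH2 _ => v /=; case: (feval v A).
  + have /provable_conseq1 : provable (axioms X) (Neg (And (Box A) (Box B))).
      apply: provable_ddia (SD AxDdia isT) _ (or_intror _).
        by apply: provable_conseq1 IH1 _ => v /=; case: (feval v A).
      by apply: provable_conseq1 IH2 _ => v /=; case: (feval v A); case: (feval v B).
    apply=> v; rewrite !fevalE E /= !implybF => /negbTE.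
    by case: (v (Box A)) => //= ->.
- move=> Pi G D /RA SD sz2 _ IH; move: sz2 IH.
  rewrite /seq_formula bigdisj0 /bigconj.
  case E: (enum_mset Pi) => [|A [|B []]] // _ IH.
  + by apply: provable_conseq1 IH _ => v.
  + have /provable_conseq2 := provable_box_mono (SD AxM isT) IH.
    apply; first exact: (P_Dbot (SD AxDbot isT)).
    by move=> v; rewrite !fevalE E /=; case: (v (Box A)) => //= ->.
  + have /provable_conseq1 : provable (axioms X) (Neg (And (Box A) (Box B))).
      apply: provable_ddia (SD AxDdia isT) _ (or_introl (SD AxM isT)).
      by apply: provable_conseq1 IH _ => v /=; case: (feval v A).
    apply=> v; rewrite !fevalE E /= !implybF => /negbTE.
    by case: (v (Box A)) => //= ->.
- move=> Pi Sigma G D /RA SD Pi0 Sigma0 _ IH1 _ IH2.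
  have boxPi := provable_box_conj (SD AxC isT) (s := Pi) (or_introl _).
  have boxSigma := provable_box_conj (SD AxC isT) (s := Sigma) (or_introl _).
  rewrite !enum_mset_eq0 in boxPi boxSigma.
  have disj : provable (axioms X)
      (Neg (And (Box (bigconj Pi)) (Box (bigconj Sigma)))).
    apply: provable_ddia (SD AxDdia isT) _ (or_intror _).
      apply: provable_conseq1 IH1 _ => v.
      rewrite feval_seq all_msetD enum_mset0 /= !feval_conj.
      by case: all; case: all.
    apply: (@provable_conseq _
      [seq seq_formula mset0 [mset A; B] | A <- Pi, B <- Sigma]) => [C|v].
      by move=> /allpairsP[[A B] [/= APi BSigma ->]]; apply: IH2.
    (* If some [B] in [Sigma] is false, the premisses for the pairs with this [B] make every [A] in
       [Pi] true. *)
    move=> /allP PiSigma; rewrite /= !feval_conj implybF.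
    apply/implyP => /allPn[B BSigma vB]; apply/allP => A APi.
    have := PiSigma _ (allpairs_f _ APi BSigma).
    by rewrite !fevalE /= (negbTE vB) orbF.
  apply: (@provable_conseq _ [:: _; _; _]) => [C|v].
    rewrite !inE => /or3P[]/eqP->.
    - exact: disj.
    - exact: boxPi.
    - exact: boxSigma.
  rewrite !fevalE /= !feval_conj !all_map /=.
  by case: (v (Box (bigconj Pi))); case: (v (Box (bigconj Sigma)));
    case: (all _ Pi); case: (all _ Sigma).
- move=> Pi G D /RA SD _ IH.
  have /provable_conseq1 := provable_dstar (SD AxC isT) (SD AxDbot isT) IH.
  apply=> v; rewrite !fevalE /= implybF => /negbTE.
  by move=> ->.
Qed.

(** * Truth of tautology instances, and consistency *)

Lemma taut_instance_feval v A : taut_instance A -> feval v A.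
Proof.
case=> P [s [tautP ->]]; rewrite (_ : feval _ _ = peval (feval v \o s) P) //.
by elim: P {tautP} => //= [P -> Q ->|P -> Q ->|P -> Q ->].
Qed.

(* Reading [Box A] as [A] validates every scheme, so all the logics are
   consistent. *)
Fixpoint erase_boxes (A : formula) : bool :=
  match A with
  | Var _ => true
  | Bot => false
  | And B C => erase_boxes B && erase_boxes C
  | Or B C => erase_boxes B || erase_boxes C
  | Imp B C => erase_boxes B ==> erase_boxes C
  | Box B => erase_boxes B
  end.

Lemma provable_erase_boxes S A : provable S A -> erase_boxes A.
Proof.
elim=> {A} //= [A|A B _ /implyP AB _ /AB|A B _|A B _|A _] //.
- move=> /(@taut_instance_feval erase_boxes); congr is_true.
  by elim: A => //= [A -> B ->|A -> B ->|A -> B ->].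
- exact: implybb.
- exact: implybb.
- by case: erase_boxes.
Qed.

Lemma provable_consistent S : ~ provable S Bot.
Proof. by move/provable_erase_boxes. Qed.

(** * Saturated sequents *)

Definition compound (A : formula) : bool :=
  match A with And _ _ | Or _ _ | Imp _ _ => true | _ => false end.

Definition saturated_left (L R : seq formula) (C : formula) : Prop :=
  match C with
  | Var n => Var n \notin R
  | Bot => False
  | And A B => A \in L /\ B \in L
  | Or A B => A \in L \/ B \in L
  | Imp A B => A \in R \/ B \in L
  | Box _ => True
  end.

Definition saturated_right (L R : seq formula) (C : formula) : Prop :=
  match C with
  | And A B => A \in R \/ B \in R
  | Or A B => A \in R /\ B \in R
  | Imp A B => A \in L /\ B \in R
  | _ => True
  end.

(** [L] and [R] matter only as sets. [sat_modal] keeps an underivable multiset sequent that carries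
    all their boxes, to which modal rules can be applied without contraction. *)
Record saturated (Rs : seq rule) (L R : seq formula) : Prop := Saturated {
  sat_left : forall C, C \in L -> saturated_left L R C;
  sat_right : forall C, C \in R -> saturated_right L R C;
  sat_modal : exists (G D : {mset formula}),
    [/\ ~ derivable Rs G D, forall A, Box A \in L -> Box A \in G
      & forall A, Box A \in R -> Box A \in D]
}.

(** A compound formula is neither a variable nor a box, so the witnesses of [sat_modal] survive. *)
Lemma saturated_consl Rs L R C : compound C -> saturated_left L R C ->
  saturated Rs L R -> saturated Rs (C :: L) R.
Proof.
move=> Ccomp CL [satL satR [G [D [GD LG RD]]]]; split.
- move=> B; rewrite inE => /predU1P[->|/satL].
    by case: C Ccomp CL => //= A1 A2 _; rewrite !inE;
      [case=> -> ->|case=> ->|case=> ->]; rewrite ?orbT; auto.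
  case: B => //= A1 A2; rewrite !inE; [case=> -> ->|case=> ->|case=> ->];
    rewrite ?orbT; auto.
- move=> B /satR; case: B => //= A1 A2; rewrite inE => -[-> ->].
  by rewrite orbT.
- exists G, D; split=> // A; rewrite inE => /predU1P[CA|/LG//].
  by rewrite -CA in Ccomp.
Qed.

Lemma saturated_consr Rs L R C : compound C -> saturated_right L R C ->
  saturated Rs L R -> saturated Rs L (C :: R).
Proof.
move=> Ccomp CR [satL satR [G [D [GD LG RD]]]]; split.
- move=> B /satL; case: B => //= [n|A1 A2]; rewrite inE.
    by rewrite negb_or => ->; case: C Ccomp {CR}.
  by case=> ->; rewrite ?orbT; auto.
- move=> B; rewrite inE => /predU1P[->|/satR].
    by case: C Ccomp CR => //= A1 A2 _; rewrite !inE;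
      [case=> ->|case=> -> ->|case=> -> ->]; rewrite ?orbT; auto.
  case: B => //= A1 A2; rewrite !inE; [case=> ->|case=> -> ->|case=> -> ->];
    rewrite ?orbT; auto.
- exists G, D; split=> // A; rewrite inE => /predU1P[CA|/RD//].
  by rewrite -CA in Ccomp.
Qed.

Fixpoint fsize (A : formula) : nat :=
  match A with
  | And B C | Or B C | Imp B C => (fsize B + fsize C).+1
  | _ => 0
  end.

Definition weight (G : {mset formula}) : nat := \sum_(A <- G) fsize A.

Lemma weight1D A G : weight (A +` G) = fsize A + weight G.
Proof.
have perm_AG : perm_eq (A +` G) (A :: G).
  by apply/allP => B _ /=; rewrite !count_mem_mset mset1DE (eq_sym A).
by rewrite /weight (perm_big _ perm_AG) big_cons.
Qed.

(** Induction on the number of connectives outside boxes: an underivable conclusion of a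
    propositional rule has an underivable premiss of smaller weight. *)
Lemma saturation Rs G D : ~ derivable Rs G D ->
  exists L R, [/\ saturated Rs L R, {subset G <= L} & {subset D <= R}].
Proof.
move: {2}(weight G + weight D).+1 (ltnSn (weight G + weight D)) => n.
elim: n G D => // n IHn G D.
(* The principal formula, dropped by the decomposition, is put back into the saturated lists. *)
have stepl C (G' : {mset formula}) L R : compound C -> saturated_left L R C ->
    saturated Rs L R -> {subset G' <= L} -> {subset D <= R} ->
    exists L R, [/\ saturated Rs L R, {subset C +` G' <= L} & {subset D <= R}].
  move=> Ccomp CL satLR GL DR; exists (C :: L), R; split=> //.
    exact: saturated_consl.
  by move=> B; rewrite in_mset1D inE => /orP[->//|/GL->]; rewrite orbT.
have stepr C (D' : {mset formula}) L R : compound C -> saturated_right L R C ->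
    saturated Rs L R -> {subset G <= L} -> {subset D' <= R} ->
    exists L R, [/\ saturated Rs L R, {subset G <= L} & {subset C +` D' <= R}].
  move=> Ccomp CR satLR GL DR; exists L, (C :: R); split=> //.
    exact: saturated_consr.
  by move=> B; rewrite in_mset1D inE => /orP[->//|/DR->]; rewrite orbT.
have sub1 (A : formula) (H : {mset formula}) (s : seq formula) :
    {subset A +` H <= s} -> A \in s /\ {subset H <= s}.
  by move=> Hs; split=> [|B BH]; apply: Hs; rewrite in_mset1D ?eqxx ?BH ?orbT.
case: (boolP (has compound G)) => [/hasP[C CG Ccomp]|noG].
  rewrite -(msetB1K CG); move: (G `\ C) => G'; rewrite weight1D.
  case: C Ccomp {CG} => // A B _ /= lt_n nGD.
  - have [||L [R [satLR /sub1[AL /sub1[BL GL]] DR]]] := IHn (A +` (B +` G')) D.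
    + by rewrite !weight1D; lia.
    + by move=> H; apply: nGD; apply: D_Land.
    + exact: stepl satLR GL DR.
  - case: (EM (derivable Rs (A +` G') D)) => [dA|ndA].
      case: (EM (derivable Rs (B +` G') D)) => [dB|ndB].
        by case: nGD; apply: D_Lor.
      have [|L [R [satLR /sub1[BL GL] DR]]] := IHn _ _ _ ndB.
        by rewrite !weight1D; lia.
      by apply: stepl satLR GL DR => //; right.
    have [|L [R [satLR /sub1[AL GL] DR]]] := IHn _ _ _ ndA.
      by rewrite !weight1D; lia.
    by apply: stepl satLR GL DR => //; left.
  - case: (EM (derivable Rs G' (A +` D))) => [dA|ndA].
      case: (EM (derivable Rs (B +` G') D)) => [dB|ndB].
        by case: nGD; apply: D_Limp.
      have [|L [R [satLR /sub1[BL GL] DR]]] := IHn _ _ _ ndB.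
        by rewrite !weight1D; lia.
      by apply: stepl satLR GL DR => //; right.
    have [|L [R [satLR GL /sub1[AR DR]]]] := IHn _ _ _ ndA.
      by rewrite !weight1D; lia.
    by apply: stepl satLR GL DR => //; left.
case: (boolP (has compound D)) => [/hasP[C CD Ccomp]|noD].
  rewrite -(msetB1K CD); move: (D `\ C) => D'; rewrite weight1D.
  case: C Ccomp {CD} => // A B _ /= lt_n nGD.
  - case: (EM (derivable Rs G (A +` D'))) => [dA|ndA].
      case: (EM (derivable Rs G (B +` D'))) => [dB|ndB].
        by case: nGD; apply: D_Rand.
      have [|L [R [satLR GL /sub1[BR DR]]]] := IHn _ _ _ ndB.
        by rewrite !weight1D; lia.
      by apply: stepr satLR GL DR => //; right.
    have [|L [R [satLR GL /sub1[AR DR]]]] := IHn _ _ _ ndA.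
      by rewrite !weight1D; lia.
    by apply: stepr satLR GL DR => //; left.
  - have [||L [R [satLR GL /sub1[AR /sub1[BR DR]]]]] := IHn G (A +` (B +` D')).
    + by rewrite !weight1D; lia.
    + by move=> H; apply: nGD; apply: D_Ror.
    + exact: stepr satLR GL DR.
  - have [||L [R [satLR /sub1[AL GL] /sub1[BR DR]]]] := IHn (A +` G) (B +` D').
    + by rewrite !weight1D; lia.
    + by move=> H; apply: nGD; apply: D_Rimp.
    + exact: stepr satLR GL DR.
(* Nothing is left to decompose: the sequent is saturated unless it is initial or a conclusion of
   the rule for [Bot]. *)
move=> _ nGD; exists G, D; split=> //; split; last by exists G, D.
- move=> C CG; have := hasPn noG C CG; case: C CG => //= [n0 nG _|BG _].
    apply/negP => nD; apply: nGD.
    by rewrite -(msetB1K nG) -(msetB1K nD); apply: D_init.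
  by apply: nGD; rewrite -(msetB1K BG); apply: D_Lbot.
- by move=> C CD; have := hasPn noD C CD; case: C CD.
Qed.

(** * Modal rules on sets of formulas *)

(** Quantifying over all multisets that contain the two sets builds weakening and contraction into
    the notion. *)
Definition derivable_set (Rs : seq rule) (s t : seq formula) : Prop :=
  forall G D : {mset formula},
    {subset s <= G} -> {subset t <= D} -> derivable Rs G D.

Lemma derivable_set_sub Rs s t s' t' : derivable_set Rs s t ->
  {subset s <= s'} -> {subset t <= t'} -> derivable_set Rs s' t'.
Proof.
move=> d_st ss' tt' G D s'G t'D; apply: d_st => A.
  by move=> /ss' /s'G.
by move=> /tt' /t'D.
Qed.

Lemma mem_seq_mset (s : seq formula) : seq_mset s =i s.
Proof. exact: perm_mem (perm_eq_seq_mset s). Qed.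

Lemma derivable_seq_mset Rs s t (G D : {mset formula}) : derivable_set Rs s t ->
  G =i s -> D =i t -> derivable Rs G D.
Proof. by move=> d_st Gs Dt; apply: d_st => A; rewrite ?Gs ?Dt. Qed.

Lemma boxes_seq_mset s : boxes (seq_mset s) = seq_mset (map Box s).
Proof. exact/eq_seq_msetP/perm_map/perm_eq_seq_mset. Qed.

(** In a list without duplicates each box has multiplicity at most one, so membership in [G]
    suffices. *)
Lemma boxes_split (s : seq formula) (G : {mset formula}) :
  uniq s -> {subset map Box s <= G} ->
  exists G', G = boxes (seq_mset s) `+` G'.
Proof.
move=> uniq_s sG; exists (G `\` boxes (seq_mset s)); apply/msetP => C.
rewrite !msetE2 boxes_seq_mset mset_seqE subnKC //.
rewrite count_uniq_mem ?map_inj_uniq //; last by move=> A B [].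
by case: (boolP (C \in _)) => //= /sG; rewrite in_mset.
Qed.

Lemma seq_mset_neq0 (s : seq formula) : s != [::] -> seq_mset s != mset0.
Proof.
case: s => // A s _; apply/eqP => s0.
by have := mem_seq_mset (A :: s) A; rewrite s0 in_mset0 mem_head.
Qed.

(** The absent axioms are recorded because, without C, a [mergeable] list has at most one element,
    as [LR_E] and [LR_M] demand, and, without M, the hypotheses of [box_right] must supply the
    converse premisses of [LR_E] and [LR_C]. *)
Variant modal_rule_spec (X : logic) : Prop :=
| SpecE of LR_E \in rules X & AxC \notin axioms X & AxM \notin axioms X
| SpecM of LR_M \in rules X & AxC \notin axioms X
| SpecC of LR_C \in rules X & AxM \notin axioms X
| SpecR of LR_R \in rules X
| SpecK of LR_K \in rules X.

Lemma modal_ruleP X : modal_rule_spec X.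
Proof.
by case: X; first [by apply: SpecE|by apply: SpecM|by apply: SpecC
  |by apply: SpecR|by apply: SpecK].
Qed.

Variant deontic_rule_spec (X : logic) : Prop :=
| SpecDiaE of L_DdiaE \in rules X & AxC \notin axioms X & AxM \notin axioms X
| SpecDiaM of L_DdiaM \in rules X & AxC \notin axioms X
| SpecDiaC of L_DdiaC \in rules X & AxM \notin axioms X
| SpecDstar of L_Dstar \in rules X.

Lemma deontic_ruleP X : AxDdia \in axioms X -> deontic_rule_spec X.
Proof.
by case: X => // _; first [by apply: SpecDiaE|by apply: SpecDiaM
  |by apply: SpecDiaC|by apply: SpecDstar].
Qed.

(* The axioms N and C yield [Box] of the conjunction of [s] from the boxes of [s]. *)
Definition mergeable (X : logic) (s : seq formula) : Prop :=
  (s != [::] \/ AxN \in axioms X) /\ (AxC \in axioms X \/ size s <= 1).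

Lemma mergeable_undup X s : mergeable X s -> mergeable X (undup s).
Proof.
move=> [s0 s1]; split; last first.
  by case: s1; [left|right; apply: leq_trans (size_undup _) _].
case: s0 => [s0|]; [left|by right].
by apply: contraNneq s0; move/undup_nil=> ->.
Qed.

(** One interface, uniform in the logic, to the rules that introduce a box on the right; the truth
    lemma needs it. *)
Lemma box_right X s B (G D : {mset formula}) : mergeable X s ->
  derivable_set (rules X) s [:: B] ->
  AxM \in axioms X \/
    (forall A, A \in s -> derivable_set (rules X) [:: B] [:: A]) ->
  {subset map Box s <= G} -> Box B \in D -> derivable (rules X) G D.
Proof.
(* [G] may contain a box only once, so repetitions in [s] are removed first. *)
wlog uniq_s : s / uniq s => [IH ms sB Bs sG BD|].
  apply: (IH (undup s)) => //; first exact: undup_uniq.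
  - exact: mergeable_undup.
  - by apply: derivable_set_sub sB _ _ => A; rewrite ?mem_undup.
  - by case: Bs => [|Bs]; [left|right=> A; rewrite mem_undup => /Bs].
  - by move=> C /mapP[A As ->]; apply/sG/map_f; rewrite -mem_undup.
move=> [s0 s1] sB Bs sG BD; rewrite -(msetB1K BD).
have [s_nil|s_cons] := eqVneq s [::].
  have dB : derivable (rules X) mset0 [mset B].
    apply: derivable_seq_mset sB _ _ => A; first by rewrite in_mset0 s_nil.
    by rewrite in_mset1 inE.
  (* An empty [mergeable] list forces N, whose rule is [R_N] or [LR_K] with empty [Pi]. *)
  have [RN|RK] : R_N \in rules X \/ LR_K \in rules X.
  - by case: s0; rewrite ?s_nil //; case: X {sB Bs dB s1}; auto.
  - exact: D_R_N.
  - rewrite -[G]mset0D (_ : mset0 = boxes mset0); first exact: D_LR_K.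
    by rewrite /boxes enum_mset0; apply/msetP => C; rewrite mset_seqE mset0E.
have d_sB : derivable (rules X) (seq_mset s) [mset B].
  apply: derivable_seq_mset sB (mem_seq_mset s) _ => A.
  by rewrite in_mset1 inE.
have d_1 A C : derivable_set (rules X) [:: A] [:: C] ->
    derivable (rules X) [mset A] [mset C].
  by move/derivable_seq_mset; apply=> E; rewrite in_mset1 inE.
case: (modal_ruleP X) => [XE XC XM|XM XC|XC XM|XR|XK].
- case: s1; rewrite ?(negbTE XC) //; case: Bs; rewrite ?(negbTE XM) // => Bs.
  case: s sB s_cons Bs sG {uniq_s s0 d_sB} => [|A []] //= sB _ Bs sG _.
  have AG : Box A \in G by apply: sG; rewrite mem_head.
  rewrite -(msetB1K AG); apply: D_LR_E => //; apply: d_1 => //.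
  by apply: Bs; rewrite mem_head.
- case: s1; rewrite ?(negbTE XC) // => s1.
  case: s sB s_cons s1 sG {uniq_s s0 d_sB Bs} => [|A []] //= sB _ _ sG.
  have AG : Box A \in G by apply: sG; rewrite mem_head.
  by rewrite -(msetB1K AG); apply: D_LR_M => //; apply: d_1.
- case: Bs; rewrite ?(negbTE XM) // => Bs.
  have [G' ->] := boxes_split uniq_s sG.
  apply: D_LR_C => //; first exact: seq_mset_neq0.
  by move=> A; rewrite mem_seq_mset => /Bs/d_1.
- have [G' ->] := boxes_split uniq_s sG.
  case: s d_sB s_cons {uniq_s s0 s1 sB Bs sG} => // A s d_sB _.
  have -> : boxes (seq_mset (A :: s)) = Box A +` boxes (seq_mset s).
    by apply/msetP => C; rewrite !boxes_seq_mset mset1DE !mset_seqE /= eq_sym.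
  rewrite -msetDA; apply: D_LR_R => //.
  have <- // : seq_mset (A :: s) = A +` seq_mset s.
  by apply/msetP => C; rewrite mset1DE !mset_seqE /= eq_sym.
- by have [G' ->] := boxes_split uniq_s sG; apply: D_LR_K.
Qed.

Lemma box_inconsistent X s (G D : {mset formula}) :
  AxDbot \in axioms X -> mergeable X s -> derivable_set (rules X) s [::] ->
  {subset map Box s <= G} -> derivable (rules X) G D.
Proof.
wlog uniq_s : s / uniq s => [IH XD ms sF sG|].
  apply: (IH (undup s)) => //; first exact: undup_uniq.
  - exact: mergeable_undup.
  - by apply: derivable_set_sub sF _ _ => A; rewrite ?mem_undup.
  - by move=> C /mapP[A As ->]; apply/sG/map_f; rewrite -mem_undup.
move=> XD [_ s1] sF sG.
have [s_nil|s_cons] := eqVneq s [::].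
  by apply: sF => // A; rewrite s_nil.
have d_s : derivable (rules X) (seq_mset s) mset0.
  by apply: derivable_seq_mset sF (mem_seq_mset s) _ => A; rewrite in_mset0.
have [G' defG] := boxes_split uniq_s sG.
(* Every logic here with C and [AxDbot] has [L_Dstar]; in the others [s] is a singleton. *)
have [Xs|XC] : L_Dstar \in rules X \/ AxC \notin axioms X.
- by case: X XD {s1 sF d_s}; auto.
- by rewrite defG; apply: D_L_Dstar.
- case: s1; rewrite ?(negbTE XC) // => s1.
  have [Xb|Xm] : L_Dbot \in rules X \/ L_DdiaM \in rules X.
  - by case: X XD XC {sF d_s}; auto.
  - case: s s1 s_cons d_s sG {uniq_s sF defG} => [|A []] //= _ _ d_s sG.
    have AG : Box A \in G by apply: sG; rewrite mem_head.
    rewrite -(msetB1K AG); apply: D_L_Dbot => //.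
    have <- // : seq_mset [:: A] = [mset A].
    by apply/msetP => C; rewrite mset_seqE msetnE /= addn0 eq_sym; case: eqP.
  - rewrite defG; apply: D_L_DdiaM => //.
    by rewrite (perm_size (perm_eq_seq_mset s)) (leq_trans s1).
Qed.

Lemma box_incompatible X s t (G D : {mset formula}) :
  AxDdia \in axioms X -> mergeable X s -> mergeable X t ->
  derivable_set (rules X) (s ++ t) [::] ->
  AxM \in axioms X \/ (forall A B, A \in s -> B \in t ->
    derivable_set (rules X) [::] [:: A; B]) ->
  {subset map Box s <= G} -> {subset map Box t <= G} ->
  derivable (rules X) G D.
Proof.
move=> XD ms mt stF stT sG tG.
(* If [s] or [t] is empty, N holds, hence [AxDbot] too, and the claim reduces to
   [box_inconsistent]. *)
have XND : AxN \in axioms X -> AxDbot \in axioms X by case: X XD {ms mt stF stT}.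
have [s_nil|s_cons] := eqVneq s [::].
  rewrite s_nil in ms stF; apply: box_inconsistent mt stF tG; apply: XND.
  by case: ms => -[].
have [t_nil|t_cons] := eqVneq t [::].
  rewrite t_nil cats0 in mt stF; apply: box_inconsistent ms stF sG; apply: XND.
  by case: mt => -[].
have stG : {subset map Box (undup (s ++ t)) <= G}.
  move=> C /mapP[A]; rewrite mem_undup mem_cat => /orP[] AX ->.
    exact/sG/map_f.
  exact/tG/map_f.
have d_st : derivable (rules X) (seq_mset (undup (s ++ t))) mset0.
  apply: derivable_seq_mset stF _ _ => A; last by rewrite in_mset0.
  by rewrite mem_seq_mset mem_undup.
have [G' defG] := boxes_split (undup_uniq _) stG.
have size_st : AxC \notin axioms X -> size (seq_mset (undup (s ++ t))) <= 2.
  move=> XC; case: ms mt => [_ +] [_]; rewrite (negbTE XC) => -[]// s1 []// t1.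
  rewrite (perm_size (perm_eq_seq_mset _)) (leq_trans (size_undup _)) //.
  by rewrite size_cat (leq_add s1 t1).
case: (deontic_ruleP XD) => [XE XC XM|XM XC|XC XM|Xs].
- case: stT; rewrite ?(negbTE XM) // => stT.
  rewrite defG; apply: D_L_DdiaE => //; first exact: size_st.
  case: ms mt => [_ +] [_]; rewrite (negbTE XC) => -[]// s1 []// t1.
  case: s t s1 t1 s_cons t_cons stT {sG tG stF stG d_st defG size_st}.
    by [].
  move=> A [] // [|B []] // _ _ _ _ stT.
  apply: derivable_seq_mset (stT A B _ _) _ _; rewrite ?mem_head // => C.
    by rewrite in_mset0.
  by rewrite mem_seq_mset mem_undup.
- by rewrite defG; apply: D_L_DdiaM => //; apply: size_st.
- case: stT; rewrite ?(negbTE XM) // => stT.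
  (* [L_DdiaC] consumes a separate box for each member of [Pi] and [Sigma], so every formula shared
     by [s] and [t] must be assigned to one side. *)
  have d_dia s' t' : uniq (s' ++ t') -> s' != [::] -> t' != [::] ->
      {subset s' <= s} -> {subset t' <= t} -> s' ++ t' =i s ++ t ->
      derivable (rules X) G D.
    move=> uniq_st s'0 t'0 s's t't mem_st.
    have sG' : {subset map Box (s' ++ t') <= G}.
      move=> C /mapP[A]; rewrite mem_cat => /orP[/s's|/t't] AX ->.
        exact/sG/map_f.
      exact/tG/map_f.
    have seq_mset_cat (r r' : seq formula) :
      seq_mset (r ++ r') = seq_mset r `+` seq_mset r'.
      by apply/msetP => C; rewrite msetE2 !mset_seqE count_cat.
    have [G2 ->] := boxes_split uniq_st sG'.
    rewrite boxes_seq_mset map_cat seq_mset_cat -!boxes_seq_mset -msetDA.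
    apply: D_L_DdiaC; rewrite ?seq_mset_neq0 //.
      rewrite -seq_mset_cat; apply: derivable_seq_mset stF _ _ => A.
        by rewrite mem_seq_mset mem_st.
      by rewrite in_mset0.
    move=> A B; rewrite !mem_seq_mset => /s's As /t't Bt.
    by apply: derivable_seq_mset (stT A B As Bt) _ _ => C;
      rewrite ?in_mset0 ?in_mset2 ?inE.
  (* [d_dia] needs disjoint parts; when [s] and [t] are the same singleton [A]
     there are none, but then [=> A] and [A =>] contradict consistency. *)
  have [t_s|t_s] := eqVneq [seq B <- undup t | B \notin s] [::]; last first.
    apply: (d_dia (undup s) [seq B <- undup t | B \notin s]) => //.
    + rewrite cat_uniq undup_uniq filter_uniq ?undup_uniq // andbT.
      by apply/hasPn => B; rewrite mem_filter /= !mem_undup => /andP[].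
    + by apply: contraNneq s_cons => /undup_nil->.
    + by move=> A; rewrite mem_undup.
    + by move=> A; rewrite mem_filter mem_undup => /andP[].
    + by move=> A; rewrite !mem_cat mem_filter !mem_undup; case: (A \in s).
  have ts : {subset t <= s}.
    move=> A At; apply: contraT => As; suff : A \in [::] by [].
    by rewrite -t_s mem_filter As mem_undup.
  (* Now [t] lies within [s], so the shared formulas go to the side of [t] instead. *)
  have [s_t|s_t] := eqVneq [seq A <- undup s | A \notin t] [::]; last first.
    apply: (d_dia [seq A <- undup s | A \notin t] (undup t)) => //.
    + rewrite uniq_catC cat_uniq undup_uniq filter_uniq ?undup_uniq // andbT.
      by apply/hasPn => A; rewrite mem_filter /= !mem_undup => /andP[].
    + by apply: contraNneq t_cons => /undup_nil->.
    + by move=> A; rewrite mem_filter mem_undup => /andP[].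
    + by move=> A; rewrite mem_undup.
    + by move=> A; rewrite !mem_cat mem_filter !mem_undup;
        case: (boolP (A \in t)) => [|_]; rewrite ?orbT.
  have st : {subset s <= t}.
    move=> A As; apply: contraT => At; suff : A \in [::] by [].
    by rewrite -s_t mem_filter At mem_undup.
  (* Both lists now have the same elements, so any partition will do: one formula [A] against the
     rest. *)
  case: s s_cons => // A s' _ in
    ts st stT stF d_dia {sG ms stG d_st defG size_st t_s s_t} *.
  have As : A \in A :: s' by rewrite mem_head.
  have [t_A|t_A] := eqVneq [seq B <- undup t | B != A] [::]; last first.
    apply: (d_dia [:: A] [seq B <- undup t | B != A]) => //.
    + by rewrite /= mem_filter eqxx filter_uniq ?undup_uniq.
    + by move=> B; rewrite inE => /eqP->.
    + by move=> B; rewrite mem_filter mem_undup => /andP[].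
    + move=> B; rewrite mem_cat [in RHS]mem_cat mem_filter mem_undup inE.
      case: (eqVneq B A) => [->|_] /=; first by rewrite As.
      by apply/idP/orP => [|[/st|]]; auto.
  have tA B : B \in t -> B = A.
    move=> Bt; apply: contraPeq t_A => BA; apply/eqP.
    by rewrite -has_filter; apply/hasP; exists B; rewrite ?mem_undup.
  have dA : derivable (rules X) mset0 [mset A].
    apply: derivable_seq_mset (stT A A As (st A As)) _ _ => B.
      by rewrite in_mset0.
    by rewrite in_mset1 !inE orbb.
  have ndA : derivable (rules X) [mset A] mset0.
    apply: stF => // B; rewrite mem_cat in_mset1 => /orP[/st|] /tA ->//.
  case: (@provable_consistent (axioms X)).
  move: (soundness dA) (soundness ndA).
  rewrite /seq_formula bigconj0 bigconj1 bigdisj0 bigdisj1 => prA prNA.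
  by apply: provable_conseq2 prA prNA _ => v /= ->.
- by rewrite defG; apply: D_L_Dstar.
Qed.

(** * The model of saturated sequents *)

Record world (X : logic) := World {
  wleft : seq formula;
  wright : seq formula;
  world_saturated : saturated (rules X) wleft wright
}.

(** Contrapositive of [saturation]: facts about worlds become premisses for the modal and deontic
    rules. *)
Lemma derivable_set_worlds X s t :
  (forall u : world X, {subset s <= wleft u} -> ~ {subset t <= wright u}) ->
  derivable_set (rules X) s t.
Proof.
move=> no_u G D sG tD; apply: contrapT => /saturation[L [R [satLR GL DR]]].
apply: (no_u (World satLR)) => A /=; first by move=> /sG/GL.
by move=> /tD/DR.
Qed.

(* [U] lies between the worlds where all of [s] is on the left and those where
   none of [s] is on the right: saturated sequents are only partial valuations,
   so each boxed formula on the left prescribes its truth set up to this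
   interval, and leaving the interval open is what makes cut unnecessary. *)
Definition neighbourhood (X : logic) (w : world X) (U : pred (world X)) : Prop :=
  exists s, [/\ mergeable X s, {subset map Box s <= wleft w},
    forall u, {subset s <= wleft u} -> U u
    & AxM \in axioms X \/ (forall u A, U u -> A \in s -> A \notin wright u)].

(** A variable on neither side of [w] counts as false. *)
Fixpoint forces (X : logic) (A : formula) (w : world X) : bool :=
  match A with
  | Var _ => A \in wleft w
  | Bot => false
  | And B C => forces B w && forces C w
  | Or B C => forces B w || forces C w
  | Imp B C => forces B w ==> forces C w
  | Box B => `[< neighbourhood w (forces B) >]
  end.

Lemma forces_feval X A (w : world X) : forces A w = feval (fun B => forces B w) A.
Proof. by elim: A => //= [B -> C ->|B -> C ->|B -> C ->]. Qed.

Lemma world_not_derivable X (w : world X) :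
  ~ (forall G D : {mset formula},
      (forall A, Box A \in wleft w -> Box A \in G) ->
      (forall A, Box A \in wright w -> Box A \in D) -> derivable (rules X) G D).
Proof.
have [_ _ [G [D [nGD LG RD]]]] := world_saturated w.
by move=> dGD; apply: nGD; apply: dGD.
Qed.

Lemma sub_boxes (s L : seq formula) (G : {mset formula}) :
  (forall A, Box A \in L -> Box A \in G) ->
  {subset map Box s <= L} -> {subset map Box s <= G}.
Proof. by move=> LG sL C /[dup] /sL + /mapP[A _ defC]; rewrite defC => /LG. Qed.

(** If the empty set is a neighbourhood through [s], no world has all of [s] on the left, so [s] is
    refutable and [w] would be derivable. *)
Lemma neighbourhood_bot X (w : world X) (U : pred (world X)) :
  AxDbot \in axioms X -> U =1 xpred0 -> ~ neighbourhood w U.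
Proof.
move=> XD U0 [s [ms sw sU _]]; apply: (@world_not_derivable _ w) => G D LG _.
apply: box_inconsistent XD ms _ (sub_boxes LG sw).
by apply: derivable_set_worlds => u /sU; rewrite U0.
Qed.

(** For complementary neighbourhoods through [s] and [t], no world has all of [s] and [t] on the
    left. When M is absent, no world has [A] in [s] and [B] in [t] both on the right either, since
    it lies in [U] or in [V]. These are the premisses of [box_incompatible]. *)
Lemma neighbourhood_dia X (w : world X) (U V : pred (world X)) :
  AxDdia \in axioms X -> V =1 predC U ->
  neighbourhood w U -> ~ neighbourhood w V.
Proof.
move=> XD VU [s [ms sw sU Us]] [t [mt tw tV Vt]].
apply: (@world_not_derivable _ w) => G D LG _.
apply: box_incompatible XD ms mt _ _ (sub_boxes LG sw) (sub_boxes LG tw).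
  apply: derivable_set_worlds => u stu _.
  have : V u by apply: tV => A At; apply: stu; rewrite mem_cat At orbT.
  by rewrite VU /= sU // => A As; apply: stu; rewrite mem_cat As.
case: Us => [|Us]; [by left|case: Vt => [|Vt]; [by left|right]].
move=> A B As Bt; apply: derivable_set_worlds => u _ ABu.
case: (boolP (U u)) => [Uu|nUu].
  by have /negP[] := Us u A Uu As; apply: ABu; rewrite mem_head.
have Vu : V u by rewrite VU.
by have /negP[] := Vt u B Vu Bt; apply: ABu; rewrite !inE eqxx orbT.
Qed.

Lemma mergeable_cat X s t : AxC \in axioms X ->
  mergeable X s -> mergeable X t -> mergeable X (s ++ t).
Proof.
move=> XC [s0 _] [t0 _]; split; last by left.
by case: s0 => [|XN]; [case: s => //; left|right].
Qed.

Theorem model_sound X A : provable (axioms X) A -> forall w : world X, forces A w.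
Proof.
elim=> {A}.
- by move=> A tA w; rewrite forces_feval; apply: taut_instance_feval.
- by move=> A B _ AB _ hA w; have /implyP := AB w; apply.
- move=> A B _ AB w /=.
  (* Neighbourhoods see only truth sets, so RE holds by extensionality. *)
  have -> : forces A = forces B :> (world X -> bool); last by rewrite implybb.
  by apply: funext => u; have := AB u => /=; case: forces; case: forces.
- move=> A B XM w /=; apply/implyP => /asboolP[s [ms sw sU _]].
  by apply/andP; split; apply/asboolP; exists s; split=> //; try (by left);
    move=> u /sU /andP[].
- move=> A B XC w /=; apply/implyP => /andP[].
  move=> /asboolP[s [ms sw sU Us]] /asboolP[t [mt tw tU Ut]].
  (* The intersection of two truth sets is prescribed by the union of their lists. *)
  apply/asboolP; exists (s ++ t); split.
  + exact: mergeable_cat.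
  + by move=> C; rewrite map_cat mem_cat => /orP[/sw|/tw].
  + move=> u stu /=; rewrite sU ?tU // => C Cs; apply: stu;
      by rewrite mem_cat Cs ?orbT.
  + case: Us => [|Us]; [by left|case: Ut => [|Ut]; [by left|right]].
    by move=> u C /= /andP[Au Bu]; rewrite mem_cat => /orP[/Us->|/Ut->].
- move=> XN w; apply/asboolP; exists [::]; split=> //; last by right.
  by split; [right|right].
- by move=> XD w /=; rewrite implybF; apply/asboolPn; apply: neighbourhood_bot.
- move=> A XD w /=; rewrite implybF; apply/implyP => /asboolP wA.
  apply/asboolPn; apply: neighbourhood_dia XD _ wA => u /=.
  by rewrite implybF.
Qed.

(** * Truth lemma and completeness *)

Lemma truth_lemma X A (w : world X) :
  (A \in wleft w -> forces A w) /\ (A \in wright w -> ~~ forces A w).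
Proof.
elim: A w => [n||A IHA B IHB|A IHA B IHB|A IHA B IHB|A IHA] w;
  have [satL satR _] := world_saturated w; split=> //=.
- by move=> nR; apply/negP => /satL /=; rewrite nR.
- by move=> /satL.
- by move=> /satL /= [/(proj1 (IHA w))-> /(proj1 (IHB w))->].
- by move=> /satR /= [/(proj2 (IHA w))/negbTE->|/(proj2 (IHB w))/negbTE->];
    rewrite ?andbF.
- by move=> /satL /= [/(proj1 (IHA w))->|/(proj1 (IHB w))->]; rewrite ?orbT.
- by move=> /satR /= [/(proj2 (IHA w))/negbTE-> /(proj2 (IHB w))/negbTE->].
- move=> /satL /= [/(proj2 (IHA w))/negbTE->//|/(proj1 (IHB w))->].
  by rewrite implybT.
- by move=> /satR /= [/(proj1 (IHA w))-> /(proj2 (IHB w))/negbTE->].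
(* By the induction hypothesis the truth set of [A] lies in the interval prescribed by [A] alone. *)
- move=> AL; apply/asboolP; exists [:: A]; split.
  + by split; [left|right].
  + by move=> C; rewrite inE => /eqP->.
  + by move=> u Au; apply: (proj1 (IHA u)); apply: Au; rewrite mem_head.
  + right=> u C Au; rewrite inE => /eqP->; apply: contraL Au.
    exact: (proj2 (IHA u)).
(* The lower bound of the interval gives the sequent from [s] to [A]; the upper bound, unless M
   holds, gives those from [A] to each member of [s]. Then [box_right] contradicts the
   underivability kept in [w]. *)
- move=> AR; apply/asboolPn => -[s [ms sw sU Us]].
  apply: (@world_not_derivable _ w) => G D LG RD.
  apply: box_right ms _ _ (sub_boxes LG sw) (RD A AR).
    apply: derivable_set_worlds => u /sU Au sub_A.
    by move: Au; apply/negP/(proj2 (IHA u))/sub_A/mem_head.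
  case: Us => [|Us]; [by left|right] => C Cs.
  apply: derivable_set_worlds => u Au Cu.
  have /negP[] := Us u C (proj1 (IHA u) (Au A (mem_head _ _))) Cs.
  exact/Cu/mem_head.
Qed.

Theorem completeness X G D :
  provable (axioms X) (seq_formula G D) -> derivable (rules X) G D.
Proof.
move=> /model_sound valid; apply: contrapT => /saturation[L [R [satLR GL DR]]].
pose w := World satLR.
have := valid w; rewrite forces_feval feval_seq => /implyP wGD.
have /wGD/hasP[A /DR AR] : all (feval (fun B => forces B w)) G.
  apply/allP => A /GL AL; rewrite -forces_feval.
  exact: (proj1 (truth_lemma A w)).
by rewrite -forces_feval; apply/negP/(proj2 (truth_lemma A w)).
Qed.

Theorem theorem6 (X : logic) (Gamma Delta : {mset formula}) :
  derivable (rules X) Gamma Delta <->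
  provable (axioms X) (Imp (bigconj Gamma) (bigdisj Delta)).
Proof. by split; [apply: soundness|apply: completeness]. Qed.
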